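(* Let $n\ge 3$ and let $X$ be the toric variety obtained by blowing up all torus-fixed points of $\mathbb{P}^n$. Then for each admissible cocharacter there is at least one fixed point $p$ such that the Białynicki-Birula cell closure $\overline{X_p^+}$ is not $\mathbb{G}_m$-convex.
   Context: Work over an algebraically closed field $\mathbb{K}$; subvarieties are closed and irreducible. $\mathbb{P}^n$ is viewed as a toric variety with its standard dense torus $T\cong\mathbb{G}_m^n$; it has $n+1$ torus-fixed points, and the blowup $X$ is a smooth projective toric variety with the same torus $T$. A cocharacter $v\colon\mathbb{G}_m\to T$ is admissible if $X^{\mathbb{G}_m}=X^T$ for the $\mathbb{G}_m$-action on $X$ induced by $v$ (equivalently $X^{\mathbb{G}_m}$ is finite). For such $v$ and $p\in X^{\mathbb{G}_m}$, the Białynicki-Birula cell is $X_p^+=\{x\in X:\lim_{t\to0}v(t)\cdot x=p\}$. A $\mathbb{G}_m$-stable subvariety $Y\subseteq X$ is $\mathbb{G}_m$-convex if for every $\mathbb{G}_m$-stable subvariety $Z\subseteq X$: $Z\subseteq Y$ if and only if $Z^{\mathbb{G}_m}\subseteq Y^{\mathbb{G}_m}$. *)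

(* Defs.v *)
(* Varieties over an algebraically closed field are treated
   classically, as sets of closed points with the Zariski topology. *)
From HB Require Import structures.
From mathcomp Require Import all_boot all_order all_algebra.
From mathcomp Require Import boolp classical_sets.
From mathcomp Require Import mpoly.

Set Implicit Arguments.
Unset Strict Implicit.
Unset Printing Implicit Defensive.

Import GRing.Theory.
Local Open Scope ring_scope.
Local Open Scope classical_set_scope.

Section ProductsOfProjectiveSpaces.
Variable K : closedFieldType.

Definition proj (m : nat) := {L : {vspace 'rV[K]_m.+1} | \dim L == 1%N}.

(* The product of copies of P^m indexed by I. *)
Definition mproj (I : finType) (m : nat) := {ffun I -> proj m}.

Variables (I : finType) (m : nat).
Implicit Types (c : I -> 'rV[K]_m.+1) (x : mproj I m) (Z S : set (mproj I m)).

(* Every c i is automatically nonzero, since x i is one-dimensional. *)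
Definition hcoords c x := forall i, val (x i) = <[c i]>%VS.

(* Variables are indexed by pairs (factor, coordinate). *)
Definition mpolyring := {mpoly K[#|{: I * 'I_m.+1}|]}.

Definition peval (F : mpolyring) c : K :=
  F.@[fun k => c (enum_val k).1 0 (enum_val k).2].

Definition multihomogeneous (F : mpolyring) :=
  exists d : I -> nat, forall u, u \in msupp F ->
    forall i, (\sum_(j < m.+1) u (enum_rank (i, j)))%N = d i.

Definition zariski_closed Z :=
  exists2 E : set mpolyring, (forall F, E F -> multihomogeneous F)
    & forall x, Z x <->
        (forall F, E F -> forall c, hcoords c x -> peval F c = 0).

Definition zariski_closure S : set (mproj I m) :=
  [set x | forall Z, zariski_closed Z -> S `<=` Z -> Z x].

Definition irreducible Z :=
  Z !=set0 /\
  forall A B : set (mproj I m), zariski_closed A -> zariski_closed B ->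
    Z `<=` A `|` B -> Z `<=` A \/ Z `<=` B.

(* [f] is a morphism from the affine line: around every point t0 it is given
   by polynomial homogeneous coordinates. *)
Definition A1_morphism (f : K -> mproj I m) :=
  forall t0 : K, exists q : I -> 'I_m.+1 -> {poly K},
    let q_at t i : 'rV[K]_m.+1 := \row_j (q i j).[t] in
    (forall i, q_at t0 i != 0) /\
    (forall t, (forall i, q_at t i != 0) -> hcoords (q_at t) (f t)).

End ProductsOfProjectiveSpaces.

Section Torus.
Variable K : closedFieldType.

Definition Gm := {t : K | t != 0}.

Definition Gm_mul (s t : Gm) : Gm :=
  exist _ (val s * val t) (mulf_neq0 (valP s) (valP t)).

Definition torus (n : nat) := {ffun 'I_n -> Gm}.

Variable n : nat.
Implicit Types s : torus n.

(* A homomorphism of algebraic groups G_m -> T. *)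
Definition cocharacter (v : Gm -> torus n) :=
  (forall t u i, v (Gm_mul t u) i = Gm_mul (v t i) (v u i)) /\
  (forall i, exists (p : {poly K}) (e : nat),
     forall t, val (v t i) = p.[val t] / val t ^+ e).

(* s = (s_1, ..., s_n) acts as diag(1, s_1, ..., s_n). *)
Definition tcoord s (j : 'I_n.+1) : K :=
  if unlift ord0 j is Some i then val (s i) else 1.

Lemma tcoord_neq0 s j : tcoord s j != 0.
Proof.
by rewrite /tcoord; case: unlift => [i|]; [exact: (valP (s i)) | exact: oner_neq0].
Qed.

Definition tscale s (c : 'rV[K]_n.+1) : 'rV[K]_n.+1 :=
  \row_j (tcoord s j * c 0 j).

Lemma tscale_is_linear s : linear (tscale s).
Proof.
by move=> a c d; apply/rowP=> j; rewrite !mxE mulrDr mulrCA.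
Qed.

HB.instance Definition _ s :=
  GRing.isLinear.Build K 'rV[K]_n.+1 'rV[K]_n.+1 _ (tscale s)
    (tscale_is_linear s).

Lemma tscale_dim s (L : {vspace 'rV[K]_n.+1}) :
  \dim L == 1%N -> \dim (linfun (tscale s) @: L) == 1%N.
Proof.
move=> /eqP dL; rewrite limg_dim_eq ?dL//.
suff -> : lker (linfun (tscale s)) = 0%VS by rewrite capv0.
apply/eqP/lker0P => c d; rewrite !lfunE /= => /rowP cd.
apply/rowP => j; move: (cd j); rewrite !mxE.
exact: (mulfI (tcoord_neq0 s j)).
Qed.

Definition tact_proj s (L : proj K n) : proj K n :=
  exist _ (linfun (tscale s) @: val L)%VS (tscale_dim s (valP L)).

Definition tact (I : finType) s (x : mproj K I n) : mproj K I n :=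
  [ffun i => tact_proj s (x i)].

End Torus.

Section Blowup.
Variables (K : closedFieldType) (n : nat).

(* P^n x (P^n)^{n+1}: the factor None is the P^n being blown up; the factor
   Some i contains the P^{n-1} attached to the coordinate point e_i, realised
   as the hyperplane {y_i = 0} of P^n. *)
Definition ambient := mproj K (option 'I_n.+1) n.

(* Bl_{e_i} P^n = {(x, y) in P^n x P^{n-1} : x_j y_k = x_k y_j, j, k <> i},
   the homogeneous form of the usual equations of the blowup of a point of
   affine space.  The n+1 centres being distinct, blowing them all up is the
   fibre product over P^n of the Bl_{e_i} P^n. *)
Definition blowup : set ambient :=
  [set p | forall c, hcoords c p -> forall i : 'I_n.+1,
     c (Some i) 0 i = 0 /\
     forall j k, j != i -> k != i ->
       c None 0 j * c (Some i) 0 k = c None 0 k * c (Some i) 0 j].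

Definition subvariety (Z : set ambient) :=
  [/\ Z `<=` blowup, zariski_closed Z & irreducible Z].

Definition T_fixed (Z : set ambient) : set ambient :=
  [set x | Z x /\ forall s : torus K n, tact s x = x].

Variable v : Gm K -> torus K n.

Definition Gm_fixed (Z : set ambient) : set ambient :=
  [set x | Z x /\ forall t, tact (v t) x = x].

Definition admissible := Gm_fixed blowup = T_fixed blowup.

Definition Gm_stable (Z : set ambient) :=
  forall t x, Z x -> Z (tact (v t) x).

(* lim_{t -> 0} v(t) x = p: the orbit map of x extends to a morphism on the
   affine line that maps 0 to p. *)
Definition has_limit (x p : ambient) :=
  exists f : K -> ambient,
    [/\ A1_morphism f, forall t, f (val t) = tact (v t) x & f 0 = p].

Definition bb_cell (p : ambient) : set ambient :=
  [set x | blowup x /\ has_limit x p].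

(* Meant for Gm-stable subvarieties Y; these properties of Y are not conjuncts,
   so that the failure of convexity is the failure of the equivalence below. *)
Definition Gm_convex (Y : set ambient) :=
  forall Z, subvariety Z -> Gm_stable Z ->
    (Z `<=` Y <-> Gm_fixed Z `<=` Gm_fixed Y).

End Blowup.

Arguments blowup : clear implicits.

(* Main.v *)
(* Rescaling homogeneous coordinates, v acts as diag(t^(w j)) with natural
   weights w j, which are pairwise distinct when v is admissible.  Choose
   w a < w b < w c < w d and let p be the fixed point (e_a, e_c) over e_a.
   A point of the cell of p has y_b = 0 in the coordinates y attached to e_c,
   hence so does every point of the cell closure Y.  Let Z be the closure of
   the orbit of (e_c, e_a + e_b + e_d) in the exceptional divisor over e_c:
   its fixed points are (e_c, e_a) and (e_c, e_d), and both lie in Y as limits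
   for tau -> 0 of the points of the cell over tau e_a + e_c and
   tau^2 e_a + e_c + tau e_d.  But y_b does not vanish on Z. *)
Require Import Defs.
From mathcomp Require Import all_boot all_order all_algebra.
From mathcomp Require Import boolp classical_sets.
From mathcomp Require Import mpoly zify.

Set Implicit Arguments.
Unset Strict Implicit.
Unset Printing Implicit Defensive.

Import GRing.Theory.

(** * Homogeneous coordinates and closed sets in products of projective spaces *)

Section PolynomialCurves.
Local Open Scope ring_scope.
Local Open Scope classical_set_scope.

Lemma vline_scale (K : fieldType) (V : vectType K) (k : K) (w : V) :
  k != 0 -> (<[k *: w]> = <[w]>)%VS.
Proof.
move=> k0; apply/eqP; rewrite eqEsubv -!memvE memvZ ?memv_line //=.
by rewrite -{1}(scalerK k0 w) memvZ ?memv_line.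
Qed.

Lemma poly_eq0_nonzeros (K : closedFieldType) (P : {poly K}) :
  (forall t, t != 0 -> P.[t] = 0) -> P = 0.
Proof.
move=> P0; apply/eqP/negPn/negP => nP.
(* The factor ['X] forces the non-root to be nonzero. *)
have /closed_nonrootP[t] : P * 'X != 0 by rewrite mulf_neq0 ?polyX_eq0.
rewrite rootM negb_or rootX => /andP[/negP nr t0]; apply: nr.
by apply/rootP/P0.
Qed.

Lemma exp_inj_nonzeros (K : closedFieldType) (k l : nat) :
  (forall t : K, t != 0 -> t ^+ k = t ^+ l) -> k = l.
Proof.
move=> ekl; have /eqP : 'X^k - 'X^l = 0 :> {poly K}.
  by apply: poly_eq0_nonzeros => t /ekl e; rewrite !hornerE e subrr.
rewrite subr_eq0 => /eqP /(congr1 (fun P : {poly K} => size P)).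
by rewrite !size_polyXn => -[].
Qed.

Variables (K : closedFieldType) (I : finType) (m : nat).
Implicit Types (c : I -> 'rV[K]_m.+1) (x : mproj K I m) (Z S : set (mproj K I m)).

Lemma hcoords_neq0 c x i : hcoords c x -> c i != 0.
Proof.
move=> /(_ i) cx; have := valP (x i); rewrite cx dim_vline.
by case: (c i != 0).
Qed.

Lemma ex_hcoords x : exists c, hcoords c x.
Proof.
exists (fun i => vpick (val (x i))) => i; have := valP (x i).
set L := val (x i) => /eqP dL; apply/eqP.
rewrite eq_sym eqEdim -memvE memv_pick dL dim_vline vpick0 /=.
by rewrite -dimv_eq0 dL.
Qed.

Lemma hcoords_point c : (forall i, c i != 0) -> {x | hcoords c x}.
Proof.
move=> c0; have d i : \dim <[c i]> == 1%N by rewrite dim_vline c0.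
by exists [ffun i => exist _ <[c i]>%VS (d i)] => i; rewrite ffunE.
Qed.

Lemma hcoords_scale (l : I -> K) c x :
  (forall i, l i != 0) -> hcoords c x -> hcoords (fun i => l i *: c i) x.
Proof. by move=> l0 cx i; rewrite cx vline_scale. Qed.

Lemma hcoords_proportional c c' x : hcoords c x -> hcoords c' x ->
  exists2 l : I -> K, (forall i, l i != 0) & forall i, c' i = l i *: c i.
Proof.
move=> cx cx'.
have /choice[l lP] : forall i, exists k, c' i = k *: c i.
  by move=> i; apply/vlineP; rewrite -cx cx' memv_line.
exists l => // i; apply: contraNneq (hcoords_neq0 i cx') => li.
by rewrite lP li scale0r.
Qed.

Lemma hcoords_inj c x y : hcoords c x -> hcoords c y -> x = y.
Proof. by move=> cx cy; apply/ffunP => i; apply/val_inj; rewrite cx cy. Qed.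

(** Two coordinate vectors of one point are proportional in each factor; this turns equality of
    points into polynomial identities. *)
Lemma hcoords_minor c c' x i j k : hcoords c x -> hcoords c' x ->
  c i 0 j * c' i 0 k = c i 0 k * c' i 0 j.
Proof.
move=> cx cx'; have [l _ ->] := hcoords_proportional cx cx'.
by rewrite !mxE mulrCA [RHS]mulrCA [c i 0 j * _]mulrC.
Qed.

(** Unlike [multihomogeneous], this exposes the degree, so that it can be tracked through products
    and powers. *)
Definition multidegree (F : mpolyring K I m) (d : I -> nat) :=
  forall u, u \in msupp F ->
    forall i, (\sum_(j < m.+1) u (enum_rank (i, j)))%N = d i.

Lemma multidegree_homogeneous F d : multidegree F d -> multihomogeneous F.
Proof. by exists d. Qed.

Lemma multidegree_var i j :
  multidegree 'X_(enum_rank (i, j)) (fun i' => (i == i')%N).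
Proof.
move=> u; rewrite msuppX inE => /eqP-> i'.
rewrite (eq_bigr (fun j' => ((i == i') && (j == j') : nat))); last first.
  by move=> j' _; rewrite mnm1E (inj_eq enum_rank_inj) xpair_eqE.
case: (i == i') => /=; last by rewrite big1.
by rewrite (bigD1 j) //= eqxx big1 // => k; rewrite eq_sym => /negPf->.
Qed.

Lemma multidegreeM F G d e : multidegree F d -> multidegree G e ->
  multidegree (F * G) (fun i => d i + e i)%N.
Proof.
move=> dF eG u /msuppM_le/allpairsP[[u1 u2] /= [/dF h1 /eG h2 ->]] i.
by rewrite -h1 -h2 -big_split /=; apply: eq_bigr => j _; rewrite mnmDE.
Qed.

Lemma multidegreeX F d k :
  multidegree F d -> multidegree (F ^+ k) (fun i => k * d i)%N.
Proof.
move=> dF; elim: k => [|k IHk].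
  move=> u; rewrite expr0 msupp1 inE => /eqP-> i.
  by rewrite big1 // => j _; rewrite mnm0E.
by rewrite exprS; apply: (multidegreeM dF IHk).
Qed.

Lemma multidegreeB F G d e : d =1 e -> multidegree F d -> multidegree G e ->
  multidegree (F - G) d.
Proof.
move=> de dF eG u /msuppB_le; rewrite mem_cat => /orP[/dF //|/eG h] i.
by rewrite h de.
Qed.

Lemma peval_var c i j : peval 'X_(enum_rank (i, j)) c = c i 0 j.
Proof. by rewrite /peval mevalXU enum_rankK. Qed.

(** Each monomial has degree [d i] in the [i]-th block of variables and so picks up [l i ^+ d i].
    Hence vanishing at a point does not depend on the coordinates chosen. *)
Lemma peval_scale F (l : I -> K) c : multihomogeneous F ->
  exists d : I -> nat,
    peval F (fun i => l i *: c i) = (\prod_i l i ^+ d i) * peval F c.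
Proof.
move=> [d dF]; exists d; rewrite /peval !mevalE mulr_sumr.
apply: eq_big_seq => u /dF du; rewrite mulrCA; congr (_ * _).
rewrite -(eq_bigr _ (fun i _ => congr1 (fun e => l i ^+ e) (du i))).
under [X in X * _]eq_bigr => i _ do rewrite -prodrXr.
rewrite pair_big /= (reindex (@enum_val _ {: I * 'I_m.+1})) /=; last first.
  exact/onW_bij/enum_val_bij.
rewrite -big_split /=; apply: eq_bigr => k _.
by rewrite mxE exprMn -surjective_pairing enum_valK.
Qed.

Lemma peval_hcoords F c c' x : multihomogeneous F -> hcoords c x ->
  hcoords c' x -> peval F c = 0 -> peval F c' = 0.
Proof.
move=> hF cx cx' Fc; have [l _ /funext ->] := hcoords_proportional cx cx'.
by have [d ->] := peval_scale l c hF; rewrite Fc mulr0.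
Qed.

Definition vanishes (F : mpolyring K I m) x := forall c, hcoords c x -> peval F c = 0.

Lemma vanishesP F c x : multihomogeneous F -> hcoords c x ->
  vanishes F x <-> peval F c = 0.
Proof.
by move=> hF cx; split=> [/(_ _ cx) //|Fc c' cx']; apply: peval_hcoords Fc.
Qed.

Lemma zariski_closed_vanishes F :
  multihomogeneous F -> zariski_closed [set x | vanishes F x].
Proof.
move=> hF; exists [set F] => [G -> //|x].
by split=> [Fx G -> //|]; apply.
Qed.

Lemma subset_zariski_closure S : S `<=` zariski_closure S.
Proof. by move=> x Sx Z _; apply. Qed.

Lemma zariski_closure_min S Z :
  zariski_closed Z -> S `<=` Z -> zariski_closure S `<=` Z.
Proof. by move=> Zc SZ x; apply. Qed.

(** The closure is the common zero locus of all multihomogeneous polynomials vanishing on [S]. *)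
Lemma zariski_closed_closure S : zariski_closed (zariski_closure S).
Proof.
exists [set F | multihomogeneous F /\ S `<=` [set x | vanishes F x]] => [F []//|x].
split=> [Sx F [hF SF]|hx Z [E hE ZE] SZ].
  exact: (Sx [set x | vanishes F x] (zariski_closed_vanishes hF) SF).
apply/ZE => F EF; apply: hx; split=> [|y /SZ/ZE]; [exact: hE | exact].
Qed.

(** * Closures of curves with polynomial coordinates *)

Definition curve_at (q : I -> 'I_m.+1 -> {poly K}) (t : K) i : 'rV[K]_m.+1 :=
  \row_j (q i j).[t].

Lemma peval_curve F q : exists P : {poly K}, forall t, peval F (curve_at q t) = P.[t].
Proof.
exists (\sum_(u <- msupp F)
  F@_u *: \prod_k q (enum_val k).1 (enum_val k).2 ^+ u k) => t.
rewrite /peval mevalE horner_sum; apply: eq_bigr => u _.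
rewrite hornerZ horner_prod; congr (_ * _); apply: eq_bigr => k _.
by rewrite horner_exp mxE.
Qed.

Section Curve.
Variables (q : I -> 'I_m.+1 -> {poly K}) (S : set (mproj K I m)).
Hypothesis param : forall t, t != 0 -> exists2 x, S x & hcoords (curve_at q t) x.

(** An equation valid on [S] pulls back to a polynomial that vanishes at all nonzero [t], hence
    identically, hence also at 0. *)
Lemma curve_limit_closure x :
  hcoords (curve_at q 0) x -> zariski_closure S x.
Proof.
move=> qx Z [E hE ZE] SZ; apply/ZE => F EF.
apply/(vanishesP (hE _ EF) qx); have [P PE] := peval_curve F q.
rewrite PE (_ : P = 0) ?horner0 //; apply: poly_eq0_nonzeros => t /param[y Sy qy].
by rewrite -PE; apply/(vanishesP (hE _ EF) qy); move/SZ/ZE: Sy => /(_ _ EF).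
Qed.

Hypothesis S_param : forall x, S x -> exists2 t, t != 0 & hcoords (curve_at q t) x.

(** Equations pull back to the domain [{poly K}], where the product of an equation of [A] and one of
    [B] becomes zero. *)
Lemma curve_closure_irreducible : irreducible (zariski_closure S).
Proof.
split.
  have [x Sx _] := param (oner_neq0 K).
  by exists x; apply: subset_zariski_closure.
move=> A B Ac Bc SAB.
suff [SA|SB] : S `<=` A \/ S `<=` B.
  by left; apply: zariski_closure_min.
  by right; apply: zariski_closure_min.
case: (pselect (S `<=` A)) => [SA|nA]; first by left.
right=> z Sz; case: Bc (SAB) => E hE BE SAB'; apply/BE => F EF.
move: nA => /existsNP[y /not_implyP[Sy nAy]].
case: Ac => EA hEA AE.
(* [G] is an equation of [A] that fails at a point of [S]; its pullback is nonzero, so every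
   equation of [B] pulls back to 0. *)
have /existsNP[G /not_implyP[EG nG]] : ~ forall G, EA G -> vanishes G y.
  by move=> h; apply: nAy; apply/AE.
have [PF PFE] := peval_curve F q; have [PG PGE] := peval_curve G q.
have : PF * PG = 0.
  apply: poly_eq0_nonzeros => t /param[x Sx qx].
  have /SAB' [/AE /(_ _ EG)|/BE /(_ _ EF)] := subset_zariski_closure Sx.
    by move=> /(vanishesP (hEA _ EG) qx); rewrite PGE hornerM => ->; rewrite mulr0.
  by move=> /(vanishesP (hE _ EF) qx); rewrite PFE hornerM => ->; rewrite mul0r.
move=> /eqP; rewrite mulf_eq0 => /orP[] /eqP P0.
  have [t t0 qz] := S_param Sz.
  by apply/(vanishesP (hE _ EF) qz); rewrite PFE P0 horner0.
have [t t0 qy] := S_param Sy.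
by case: nG; apply/(vanishesP (hEA _ EG) qy); rewrite PGE P0 horner0.
Qed.

End Curve.

(** Composing [F] with a diagonal map only multiplies each coefficient by a monomial in [r]; no new
    monomial appears, so the multidegree is kept. *)
Lemma zariski_closed_rescale (r : I -> 'I_m.+1 -> K) (g : mproj K I m -> mproj K I m) Z :
  (forall c x, hcoords c x -> hcoords (fun i => \row_j (r i j * c i 0 j)) (g x)) ->
  zariski_closed Z -> zariski_closed [set x | Z (g x)].
Proof.
move=> rg [E hE ZE].
pose R (k : 'I_#|{: I * 'I_m.+1}|) := r (enum_val k).1 (enum_val k).2.
pose sc (F : mpolyring K I m) : mpolyring K I m :=
  \sum_(u <- msupp F) (F@_u * \prod_k R k ^+ u k) *: 'X_[u].
have peval_sc F c : peval (sc F) c = peval F (fun i => \row_j (r i j * c i 0 j)).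
  rewrite /peval [RHS]mevalE /sc raddf_sum /=; apply: eq_bigr => u _.
  rewrite mevalZ mevalX -mulrA; congr (_ * _); rewrite -big_split /=.
  by apply: eq_bigr => k _; rewrite mxE exprMn.
have sc_hom F : multihomogeneous F -> multihomogeneous (sc F).
  move=> [d dF]; exists d => u uF; apply: dF; move: uF.
  rewrite /sc !mcoeff_msupp; apply: contraNneq => Fu.
  rewrite raddf_sum /= big1_seq // => u' /= u'F.
  rewrite mcoeffZ mcoeffX; have [e|] := eqVneq u' u; last by rewrite mulr0.
  by rewrite e Fu mul0r mul0r.
exists (sc @` E) => [_ [F /hE/sc_hom hF <-] //|x].
have [c cx] := ex_hcoords x; split=> [/ZE Zgx _ [F EF <-] c' c'x|h].
  by rewrite peval_sc; apply: Zgx EF _ (rg _ _ c'x).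
apply/ZE => F EF; apply/(vanishesP (hE _ EF) (rg _ _ cx)).
by rewrite -peval_sc; apply: h cx; exists F.
Qed.

End PolynomialCurves.

(** * Weights of a cocharacter *)

Section Weights.
Local Open Scope ring_scope.
Local Open Scope classical_set_scope.
Variables (K : closedFieldType) (n : nat).
Implicit Types (s : torus K n) (j k : 'I_n.+1).

Lemma tcoord_separates j k :
  j != k -> exists s, tcoord s j != tcoord s k.
Proof.
(* The torus coordinate at [ord0] is constantly 1, so the one to vary must have another index; by
   symmetry it is [j]. *)
wlog [i ->] : j k / exists i, j = lift ord0 i.
  move=> wl; case: (unliftP ord0 j) => [i -> jk|->]; first by apply: wl jk; exists i.
  case: (unliftP ord0 k) => [i ->|->]; last by rewrite eqxx.
  rewrite eq_sym => kj; have [|s] := wl (lift ord0 i) ord0 _ kj; first by exists i.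
  by rewrite eq_sym; exists s.
move=> ik; have /closed_nonrootP[l] : ('X * ('X - 1%:P) : {poly K}) != 0.
  by rewrite mulf_neq0 ?polyX_eq0 ?polyXsubC_eq0.
rewrite rootM negb_or rootX root_XsubC => /andP[l0 l1].
pose g (i' : 'I_n) : Gm K :=
  if i' == i then exist _ l l0 else exist _ 1 (oner_neq0 K).
exists [ffun i' => g i']; rewrite /tcoord liftK ffunE /g eqxx /=.
case: unliftP ik => [i' ->|_ _] //; rewrite ffunE (inj_eq lift_inj) eq_sym.
by move=> /negPf->.
Qed.

Lemma hcoords_tact (I : finType) s (c : I -> 'rV[K]_n.+1) x :
  hcoords c x -> hcoords (fun i => tscale s (c i)) (tact s x).
Proof. by move=> cx i; rewrite ffunE /= cx limg_line lfunE. Qed.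

(* Homogeneous coordinates are only defined up to a common factor, so the
   weights of v may be taken to be natural numbers. *)
Definition weights (v : Gm K -> torus K n) (w : 'I_n.+1 -> nat) :=
  forall t (I : finType) (c : I -> 'rV[K]_n.+1) x, hcoords c x ->
    hcoords (fun i => \row_j (val t ^+ w j * c i 0 j)) (tact (v t) x).

(** The polynomial splits and 0 is its only possible root; evaluation at 1 recovers the leading
    coefficient. *)
Lemma nonvanishing_poly_monomial (p : {poly K}) :
  (forall t, t != 0 -> p.[t] != 0) -> exists e, p = p.[1] *: 'X^e.
Proof.
move=> pn0; have [r rE] := closed_field_poly_normal p.
have p1 : p.[1] != 0 by apply/pn0/oner_neq0.
have p0 : lead_coef p != 0.
  by rewrite lead_coef_eq0; apply: contraNneq p1 => ->; rewrite horner0.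
have r0 z : z \in r -> z = 0.
  move=> zr; apply/eqP; apply: contraTT zr => /pn0.
  by rewrite -/(root p z) rE rootZ // root_prod_XsubC.
exists (size r); have pE : p = lead_coef p *: 'X^(size r).
  rewrite {1}rE; congr (_ *: _); rewrite big_seq.
  rewrite (eq_bigr (fun=> 'X)) => [|z /r0 ->]; last by rewrite subr0.
  by rewrite -big_seq big_const_seq count_predT iter_mulr_1.
by rewrite {2}pE hornerZ hornerXn expr1n mulr1 -pE.
Qed.

(** The numerator of each component has no nonzero root, so it is a constant times a power of [t];
    the constant is 1 because [v] sends 1 to 1. *)
Lemma cocharacter_weights v : cocharacter v -> exists w, weights v w.
Proof.
move=> [vM vp].
have /choice[we weP] : forall i, exists we : nat * nat,
    forall t, val (v t i) = val t ^+ we.1 / val t ^+ we.2.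
  move=> i; have [p [e pe]] := vp i.
  have [|k pk] := nonvanishing_poly_monomial (p := p).
    move=> t t0; apply: contra_neq (valP (v (exist _ t t0) i)) => pt.
    by rewrite pe /= pt mul0r.
  exists (k, e) => t; rewrite pe pk hornerZ hornerXn (_ : p.[1] = 1) ?mul1r //.
  pose o : Gm K := exist _ 1 (oner_neq0 K).
  have oo : Gm_mul o o = o by apply: val_inj; rewrite /= mulr1.
  have vo0 : val (v o i) != 0 := valP (v o i).
  have /(congr1 val) /= := vM o o i; rewrite oo -{1}[val (v o i)]mulr1.
  by move=> /(mulfI vo0)/esym; rewrite pe /= expr1n invr1 mulr1.
pose e j := if unlift ord0 j is Some i then (we i).2 else 0%N.
pose k j := if unlift ord0 j is Some i then (we i).1 else 0%N.
(* [N] bounds all the denominator exponents, so rescaling by [t ^+ N] makes every exponent natural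
   without moving the point. *)
pose N := (\sum_j e j)%N.
have eN j : (e j <= N)%N by rewrite /N (bigD1 j) //= leq_addr.
exists (fun j => k j + (N - e j))%N => t I c x cx.
have t0 : val t != 0 := valP t.
have := hcoords_scale (fun=> expf_neq0 N t0) (hcoords_tact (v t) cx).
congr hcoords; apply/funext => i; apply/rowP => j; rewrite !mxE mulrA.
congr (_ * _); rewrite /tcoord.
have /subnKC {1}<- := eN j; rewrite /e /k.
case: unlift => [l|]; rewrite ?mulr1 ?add0n ?subn0 // weP.
by rewrite !exprD mulrC mulrA mulfVK ?expf_neq0.
Qed.
End Weights.

(** * Limits at coordinate points in terms of weights *)

Section BialynickiBirula.
Local Open Scope ring_scope.
Local Open Scope classical_set_scope.
Variables (K : closedFieldType) (n : nat) (v : Gm K -> torus K n).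
Variable w : 'I_n.+1 -> nat.
Hypothesis vw : weights v w.
Hypothesis w_inj : injective w.
Implicit Types (x p : ambient K n) (mu : option 'I_n.+1 -> 'I_n.+1).
Implicit Types C : option 'I_n.+1 -> 'rV[K]_n.+1.

(** Dividing the [i]-th factor by [t ^+ w (mu i)] extends the orbit map to 0, where only the
    coordinate [mu i] survives. *)
Lemma has_limit_monomial C x p mu : hcoords C x ->
  hcoords (fun i => delta_mx 0 (mu i)) p ->
  (forall i, C i 0 (mu i) != 0 /\ forall k, (w k < w (mu i))%N -> C i 0 k = 0) ->
  has_limit v x p.
Proof.
move=> Cx ep Cmu.
(* Truncated subtraction is harmless: [C i 0 j] vanishes wherever [w j < w (mu i)]. *)
pose q i j := C i 0 j *: 'X^(w j - w (mu i)) : {poly K}.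
have q_mu t i : (q i (mu i)).[t] != 0.
  by rewrite /q subnn hornerZ hornerXn mulr1; have [] := Cmu i.
have q0 t i : curve_at q t i != 0.
  by apply: contraNneq (q_mu t i) => /rowP/(_ (mu i)); rewrite !mxE => ->.
pose f t := projT1 (hcoords_point (q0 t)).
have qf t : hcoords (curve_at q t) (f t) by rewrite /f; case: hcoords_point.
exists f; split.
- by move=> t0; exists q; split=> [i|t _]; [exact: q0 | exact: qf].
- move=> t; have t0 : val t != 0 := valP t.
  apply/esym/(hcoords_inj (vw t Cx)).
  have := hcoords_scale (fun i => expf_neq0 (w (mu i)) t0) (qf (val t)).
  congr hcoords; apply/funext => i; apply/rowP => j; rewrite !mxE hornerZ hornerXn.
  have [/(proj2 (Cmu i))->|ij] := ltnP (w j) (w (mu i)).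
    by rewrite !(mul0r, mulr0).
  by rewrite mulrCA -exprD subnKC // mulrC.
- apply: (hcoords_inj (qf 0)).
  have := hcoords_scale (fun i => proj1 (Cmu i)) ep.
  congr hcoords; apply/funext => i; apply/rowP => j.
  rewrite !mxE hornerZ hornerXn /=; have [->|jmu] := eqVneq j (mu i).
    by rewrite subnn.
  rewrite mulr0; have [/(proj2 (Cmu i))->|ij] := ltnP (w j) (w (mu i)).
    by rewrite mul0r.
  (* By injectivity of [w], the remaining exponents are positive, so these coordinates vanish at
     0. *)
  rewrite expr0n subn_eq0 leqNgt ltn_neqAle ij andbT (inj_eq w_inj).
  by rewrite eq_sym jmu mulr0.
Qed.

(** Near 0 the extended orbit map has polynomial coordinates [q], proportional to the monomial ones.
    At 0 only the coordinate [mu i] of [q] survives, so comparing orders of vanishing there gives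
    the conditions. *)
Lemma has_limit_coords C x p mu : hcoords C x ->
  hcoords (fun i => delta_mx 0 (mu i)) p -> has_limit v x p ->
  forall i, C i 0 (mu i) != 0 /\ forall k, (w k < w (mu i))%N -> C i 0 k = 0.
Proof.
move=> Cx ep [f [mor fv f0]] i.
have [q [q0 qf]] := mor 0.
have /choice[m mP] : forall i, exists j, (q i j).[0] != 0.
  move=> i'; have /rV0Pn[j] := q0 i'; rewrite mxE; by exists j.
(* [G] multiplies one coordinate per factor that is nonzero at 0. Off its zeros [q] gives valid
   coordinates in all factors at once, so identities are tested after multiplication by [G]. *)
pose G := \prod_i' q i' (m i').
have G0 : G != 0.
  have : G.[0] != 0 by rewrite horner_prod; apply/prodf_neq0 => i' _.
  by apply: contraNneq => ->; rewrite horner0.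
have minors j k : q i j * (C i 0 k *: 'X^(w k)) = q i k * (C i 0 j *: 'X^(w j)).
  apply/eqP; rewrite -subr_eq0 -(mulIr_eq0 _ (mulIf G0)); apply/eqP.
  apply: poly_eq0_nonzeros => t t0; rewrite hornerM.
  have [->|Gt] := eqVneq G.[t] 0; first by rewrite mulr0.
  have qt : hcoords (curve_at q t) (f t).
    apply: qf => i'; apply/rV0Pn; exists (m i'); rewrite mxE.
    by move: Gt; rewrite horner_prod => /prodf_neq0; apply.
  have := vw (exist _ t t0) Cx; rewrite -fv /= => Ct.
  have := hcoords_minor i j k qt Ct; rewrite !mxE !hornerE => e.
  by rewrite [X in X - _]mulrAC [X in _ - X]mulrAC e subrr mul0r.
have qp : hcoords (curve_at q 0) p by rewrite -f0; exact: qf q0.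
have qmu0 k : k != mu i -> (q i k).[0] = 0.
  move=> kmu; have := hcoords_minor i k (mu i) qp ep.
  by rewrite !mxE !eqxx (negPf kmu) /= mulr0 mulr1.
have qmu : (q i (mu i)).[0] != 0.
  by have := mP i; have [<-|/qmu0->] := eqVneq (m i) (mu i); rewrite ?eqxx.
have qmuP : q i (mu i) != 0 by apply: contraNneq qmu => ->; rewrite horner0.
split.
  have /rV0Pn[k Ck] := hcoords_neq0 i Cx.
  apply: contraNneq Ck => Cmu; have := minors (mu i) k.
  rewrite Cmu scale0r mulr0 => /eqP; rewrite mulf_eq0 (negPf qmuP) /=.
  by rewrite scaler_eq0 expf_eq0 polyX_eq0 andbF orbF.
move=> k kmu; pose d := (w (mu i) - w k)%N.
(* Cancelling ['X^(w k)] leaves a factor ['X^d] with [d] positive, so evaluation at 0 kills the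
   second term. *)
have : (C i 0 k *: q i (mu i) - C i 0 (mu i) *: (q i k * 'X^d)) * 'X^(w k) = 0.
  rewrite mulrBl -!scalerAl -mulrA -exprD subnK 1?ltnW //.
  by rewrite !scalerAr minors subrr.
move=> /eqP; rewrite mulf_eq0 expf_eq0 polyX_eq0 andbF orbF subr_eq0.
move=> /eqP/(congr1 (fun P => P.[0])); rewrite !(hornerZ, hornerM) hornerXn.
rewrite expr0n subn_eq0 leqNgt kmu !mulr0 => /eqP.
by rewrite mulf_eq0 (negPf qmu) orbF => /eqP.
Qed.
End BialynickiBirula.

(** * Points of the blowup, and admissibility *)

Section Blowup.
Local Open Scope ring_scope.
Local Open Scope classical_set_scope.
Variables (K : closedFieldType) (n : nat).
Implicit Types (x p : ambient K n) (C : option 'I_n.+1 -> 'rV[K]_n.+1).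
Implicit Types (c l : 'I_n.+1) (tau : K) (y : 'rV[K]_n.+1).

Lemma blowup_hcoords C x : hcoords C x ->
  (forall i : 'I_n.+1, C (Some i) 0 i = 0 /\
     forall j k, j != i -> k != i ->
       C None 0 j * C (Some i) 0 k = C None 0 k * C (Some i) 0 j) ->
  blowup K n x.
Proof.
move=> Cx CB c' c'x i; have [l _ c'E] := hcoords_proportional Cx c'x.
have [C0 CC] := CB i; rewrite !c'E !mxE C0 mulr0; split=> // j k ji ki.
by rewrite !mxE mulrACA CC // mulrACA.
Qed.

(* The point over e_c + tau y of P^n; for tau = 0 it is the point y of the
   exceptional divisor over e_c. *)
Definition near_center (c : 'I_n.+1) (tau : K) (y : 'rV[K]_n.+1) i : 'rV[K]_n.+1 :=
  let z := delta_mx 0 c + tau *: y in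
  if i is Some k then
    if k == c then y else \row_j (if j == k then 0 else z 0 j)
  else z.

Lemma near_center_neq0 c tau y : y 0 c = 0 -> y != 0 ->
  forall i, near_center c tau y i != 0.
Proof.
move=> yc y0 [k|] /=; last first.
  by apply/rV0Pn; exists c; rewrite !mxE !eqxx yc mulr0 addr0 oner_neq0.
have [//|kc] := eqVneq k c; apply/rV0Pn; exists c.
by rewrite !mxE [c == k]eq_sym (negPf kc) !eqxx yc mulr0 addr0 oner_neq0.
Qed.

Lemma near_center_blowup c tau y x : y 0 c = 0 ->
  hcoords (near_center c tau y) x -> blowup K n x.
Proof.
move=> yc hx; apply: (blowup_hcoords hx) => i /=.
have [->|ic] := eqVneq i c.
  split=> // j k jc kc; rewrite !mxE (negPf jc) (negPf kc) !add0r.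
  by rewrite -!mulrA [y 0 j * _]mulrC.
by split=> [|j k ji ki]; rewrite !mxE ?eqxx // (negPf ji) (negPf ki) mulrC.
Qed.

(* The torus-fixed point (e_c, e_l) over e_c. *)
Definition flag (c l : 'I_n.+1) (i : option 'I_n.+1) :=
  if i == Some c then l else c.

Definition flag_coords c l i : 'rV[K]_n.+1 := delta_mx 0 (flag c l i).

Lemma flag_coordsE c l : flag_coords c l = near_center c 0 (delta_mx 0 l).
Proof.
apply/funext => -[k|]; rewrite /flag_coords /flag /= scale0r addr0 //.
rewrite (inj_eq Some_inj); have [//|kc] := eqVneq k c.
apply/rowP => j; rewrite !mxE /=.
by case: (eqVneq j k) => // ->; rewrite (negPf kc).
Qed.

Lemma flag_point c l : l != c -> exists2 p, hcoords (flag_coords c l) p & blowup K n p.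
Proof.
move=> lc; have lc0 : (delta_mx 0 l : 'rV[K]_n.+1) 0 c = 0.
  by rewrite mxE eq_sym (negPf lc) andbF.
have [|p hp] := hcoords_point (near_center_neq0 0 lc0 _).
  by apply/rV0Pn; exists l; rewrite mxE !eqxx oner_neq0.
by exists p; [rewrite flag_coordsE | apply: near_center_blowup hp].
Qed.

Variables (v : Gm K -> torus K n) (w : 'I_n.+1 -> nat).
Hypothesis vw : weights v w.

Lemma flag_fixed c l p t : hcoords (flag_coords c l) p -> tact (v t) p = p.
Proof.
move=> hp; have t0 : val t != 0 := valP t.
apply: (hcoords_inj (vw t hp)).
have := hcoords_scale (fun i => expf_neq0 (w (flag c l i)) t0) hp.
congr hcoords; apply/funext => i; apply/rowP => j; rewrite !mxE /=.
by have [->|] := eqVneq j (flag c l i); rewrite // !mulr0.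
Qed.

(** If [j] and [k] had equal weights, the point over e_j + e_k would be fixed by [v], since its
    coordinates involve only these two indices, but not by the whole torus. *)
Lemma admissible_weights_inj : admissible v -> injective w.
Proof.
move=> adm j k wjk; apply/eqP/negPn/negP => jk.
have kj0 : (delta_mx 0 k : 'rV[K]_n.+1) 0 j = 0 by rewrite mxE (negPf jk) andbF.
have [|x hx] := hcoords_point (near_center_neq0 1 kj0 _).
  by apply/rV0Pn; exists k; rewrite mxE !eqxx oner_neq0.
have : Gm_fixed v (blowup K n) x.
  split=> [|t]; first exact: near_center_blowup hx.
  have t0 : val t != 0 := valP t.
  apply: (hcoords_inj (vw t hx)).
  have := hcoords_scale (fun=> expf_neq0 (w j) t0) hx.
  congr hcoords; apply/funext => i; apply/rowP => l; rewrite !mxE.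
  have [->//|lj] := eqVneq l j; have [->|lk] := eqVneq l k; first by rewrite wjk.
  suff -> : near_center j 1 (delta_mx 0 k) i 0 l = 0 by rewrite !mulr0.
  case: i => [i|] /=; last first.
    by rewrite !mxE (negPf lj) (negPf lk) mulr0 addr0.
  case: (i == j); rewrite !mxE ?(negPf lj) ?(negPf lk) //= mulr0 addr0.
  by case: (l == i).
rewrite adm => -[_ fx]; have [s] := tcoord_separates K jk.
have := hcoords_tact s hx; rewrite fx => hs.
have := hcoords_minor None j k hx hs.
rewrite !mxE !eqxx (negPf jk) [k == j]eq_sym (negPf jk) /= => e.
by move: e; rewrite !(mulr0, mulr1, addr0, add0r, mul1r) => ->; rewrite eqxx.
Qed.

(** * The cell closure at (e_a, e_c) *)

Hypothesis w_inj : injective w.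
Variables (a b c d : 'I_n.+1).
Hypotheses (wab : (w a < w b)%N) (wbc : (w b < w c)%N) (wcd : (w c < w d)%N).

Let neqw j k : (w j < w k)%N -> ((j == k) = false) * ((k == j) = false).
Proof.
move=> jk; suff e : (j == k) = false by split; rewrite // eq_sym.
by apply: contraTF jk => /eqP->; rewrite ltnn.
Qed.

Let wac : (w a < w c)%N. Proof. exact: ltn_trans wbc. Qed.
Let wbd : (w b < w d)%N. Proof. exact: ltn_trans wcd. Qed.
Let wad : (w a < w d)%N. Proof. exact: ltn_trans wcd. Qed.

Let neqs := (neqw wab, neqw wac, neqw wad, neqw wbc, neqw wbd, neqw wcd).

Variable p : ambient K n.
Hypothesis p_flag : hcoords (flag_coords a c) p.

(** The limit forces x_a to be nonzero and, in the factor [Some a], coordinate [c] nonzero and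
    coordinate [b] zero. The equations over e_a then give x_b = 0, and those over e_c give the
    claim. *)
Lemma bb_cell_vanish C x : bb_cell v p x -> hcoords C x -> C (Some c) 0 b = 0.
Proof.
move=> [xB xp] Cx; have lim := has_limit_coords vw Cx p_flag xp.
have [/= Ca _] := lim None; have [] := lim (Some a); rewrite /flag eqxx => Cc.
move=> /(_ b wbc) Cb.
have [_ /(_ b c)] := xB _ Cx a; rewrite Cb mulr0 !neqs => /(_ isT isT)/eqP.
rewrite mulf_eq0 (negPf Cc) orbF => /eqP C0b.
have [_ /(_ a b)] := xB _ Cx c; rewrite C0b mul0r !neqs => /(_ isT isT)/eqP.
by rewrite mulf_eq0 (negPf Ca) => /eqP.
Qed.

Lemma bb_closure_vanish C x : zariski_closure (bb_cell v p) x -> hcoords C x ->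
  C (Some c) 0 b = 0.
Proof.
move=> Yx Cx; have hF := multidegree_homogeneous (@multidegree_var K _ n (Some c) b).
rewrite -peval_var; apply/(vanishesP hF Cx).
apply: (zariski_closure_min (zariski_closed_vanishes hF) _ Yx) => x' cx' c' Cx'.
by rewrite peval_var; apply: bb_cell_vanish cx' Cx'.
Qed.

(** In every factor but [Some a] the nonzero coordinate of lowest weight is [a]; in [Some a] that
    coordinate is removed and [c] comes lowest. This is the pattern [flag a c]. *)
Lemma bb_cell_near_center (tau l u : K) x : tau * l != 0 ->
  hcoords (near_center c tau (l *: delta_mx 0 a + u *: delta_mx 0 d)) x ->
  bb_cell v p x.
Proof.
set y := _ + u *: _ => tl0 hx.
have /norP[tau0 l0] : ~~ ((tau == 0) || (l == 0)) by rewrite -mulf_eq0.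
have yE k : y 0 k = l * (k == a)%:R + u * (k == d)%:R by rewrite !mxE.
have yc : y 0 c = 0 by rewrite yE !neqs !mulr0 addr0.
have ya : y 0 a = l by rewrite yE eqxx neqs mulr1 mulr0 addr0.
have y0 k : (w k < w c)%N -> k != a -> y 0 k = 0.
  move=> kc /negPf ka; rewrite yE ka (neqw (ltn_trans kc wcd)) !mulr0 addr0 //.
pose z := delta_mx 0 c + tau *: y.
have zc : z 0 c = 1 by rewrite mxE [X in _ + X]mxE yc mulr0 addr0 mxE !eqxx.
have zE k : (w k < w c)%N -> z 0 k = tau * y 0 k.
  by move=> /neqw kc; rewrite !mxE kc andbF add0r.
have za : z 0 a != 0 by rewrite zE // ya.
have lt_a k : (w k < w a)%N -> y 0 k = 0 /\ z 0 k = 0.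
  move=> ka; have kc := ltn_trans ka wac.
  by rewrite zE // y0 ?mulr0 // (neqw ka).
split; first exact: near_center_blowup hx.
apply: (has_limit_monomial vw w_inj hx p_flag) => -[i|]; rewrite /flag /=; last first.
  by split=> // k /lt_a[].
rewrite (inj_eq Some_inj); have [->|ic] := eqVneq i c.
  by rewrite neqs ya; split=> // k /lt_a[].
have [->|ia] := eqVneq i a; rewrite mxE -/y -/z.
  rewrite neqs; split=> [|k kc]; first by rewrite -/z zc oner_neq0.
  by rewrite mxE; have [//|ka] := eqVneq k a; rewrite -/z zE // y0 // mulr0.
rewrite [a == i]eq_sym (negPf ia); split=> // k /lt_a[_ zk].
by rewrite mxE -/z zk; case: ifP.
Qed.

Lemma bb_closure_flag l x : l = a \/ l = d -> hcoords (flag_coords c l) x ->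
  zariski_closure (bb_cell v p) x.
Proof.
(* The curve has y = e_a if [l = a] and y = t e_a + e_d if [l = d]: the coefficient of e_a is
   nonzero for nonzero t, as the cell requires, and y tends to e_l. *)
move=> lad; pose P : {poly K} := if l == a then 1 else 'X.
pose Q : {poly K} := if l == a then 0 else 1.
pose y t : 'rV[K]_n.+1 := P.[t] *: delta_mx 0 a + Q.[t] *: delta_mx 0 d.
pose yq j := P * (j == a)%:R + Q * (j == d)%:R.
pose zq j := (j == c)%:R + 'X * yq j.
pose q (i : option 'I_n.+1) j : {poly K} :=
  if i is Some k then if k == c then yq j else if j == k then 0 else zq j
  else zq j.
have hornerb (e : bool) t : (e%:R : {poly K}).[t] = e%:R by case: e; rewrite hornerE.
have yqE j t : (yq j).[t] = y t 0 j by rewrite !mxE !(hornerD, hornerM) !hornerb.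
have zqE j t : (zq j).[t] = (delta_mx 0 c + t *: y t) 0 j.
  by rewrite mxE [X in _ + X]mxE -yqE !hornerE hornerb mxE.
have qE t : curve_at q t = near_center c t (y t).
  apply/funext => -[k|]; apply/rowP => j; rewrite mxE /= ?zqE //.
  by case: (k == c); [rewrite yqE | rewrite mxE; case: (j == k); rewrite ?zqE ?horner0].
have y0 : y 0 = delta_mx 0 l.
  rewrite /y /P /Q; case: lad => ->; rewrite ?eqxx ?neqs !hornerE ?scale1r ?scale0r.
    by rewrite addr0.
  by rewrite add0r.
rewrite flag_coordsE -y0 -qE; apply: curve_limit_closure => t t0.
have P0 : P.[t] != 0 by rewrite /P; case: ifP; rewrite hornerE ?oner_neq0.
have yc : y t 0 c = 0 by rewrite !mxE !neqs !mulr0 addr0.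
have [|x' hx'] := hcoords_point (near_center_neq0 t yc _).
  by apply/rV0Pn; exists a; rewrite !mxE !neqs !eqxx /= mulr1 mulr0 addr0.
exists x'; last by rewrite qE.
by apply: bb_cell_near_center hx'; rewrite mulf_neq0.
Qed.

(** * The orbit closure in the exceptional divisor over e_c *)

Definition orbit_curve (i : option 'I_n.+1) (j : 'I_n.+1) : {poly K} :=
  if i == Some c then (if [|| j == a, j == b | j == d] then 'X^(w j) else 0)
  else (j == c)%:R.

Definition orbit : set (ambient K n) :=
  [set x | exists2 t, t != 0 & hcoords (curve_at orbit_curve t) x].

Lemma orbit_param t : t != 0 ->
  exists2 x, orbit x & hcoords (curve_at orbit_curve t) x.
Proof.
move=> t0; suff [x hx] : {x | hcoords (curve_at orbit_curve t) x}.
  by exists x => //; exists t.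
apply: hcoords_point => i; apply/rV0Pn.
exists (if i == Some c then a else c); rewrite mxE /orbit_curve.
by case: (i == Some c); rewrite eqxx /= ?hornerXn ?expf_neq0 // hornerE oner_neq0.
Qed.

Lemma orbit_stable t x : orbit x -> orbit (tact (v t) x).
Proof.
move=> [u u0 hx]; have t0 : val t != 0 := valP t.
exists (val t * u); first exact: mulf_neq0.
(* Outside the factor [Some c] the curve is constantly e_c, so the factor [val t ^+ w c] produced by
   [v] is divided out. *)
pose l (i : option 'I_n.+1) := if i == Some c then 1 else (val t ^+ w c)^-1.
have l0 i : l i != 0.
  by rewrite /l; case: ifP => _; rewrite ?oner_neq0 // invr_eq0 expf_neq0.
have := hcoords_scale l0 (vw t hx).
congr hcoords; apply/funext => i; apply/rowP => j; rewrite !mxE /l /orbit_curve.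
case: (i == Some c).
  by rewrite mul1r; case: ifP => _; rewrite !hornerE ?mulr0 // exprMn.
have [->|_] := eqVneq j c; last by rewrite !horner0 !mulr0.
by rewrite /= -polyC1 !hornerC mulr1 mulVf ?expf_neq0.
Qed.

(** The preimage under [tact (v t)] of a closed set containing the orbit is again closed and
    contains the orbit. *)
Lemma orbit_closure_stable : Gm_stable v (zariski_closure orbit).
Proof.
move=> t x Zx W Wc SW.
have := zariski_closed_rescale
  (g := tact (v t)) (r := fun=> fun j => val t ^+ w j) (@vw t _) Wc.
by move=> /Zx; apply=> y oy; apply/SW/orbit_stable.
Qed.

(* The orbit satisfies y_b ^ (w d - w a) = y_a ^ (w d - w b) y_d ^ (w b - w a);
   this is what excludes the fixed point (e_c, e_b) from its closure. *)
Lemma orbit_closure_coords C x : zariski_closure orbit x -> hcoords C x ->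
  [/\ forall i k, i != Some c -> k != c -> C i 0 k = 0,
      forall k, ~~ [|| k == a, k == b | k == d] -> C (Some c) 0 k = 0
    & C (Some c) 0 b ^+ (w d - w a) =
        C (Some c) 0 a ^+ (w d - w b) * C (Some c) 0 d ^+ (w b - w a)].
Proof.
move=> Zx Cx.
have vanish F e : multidegree F e ->
    (forall t, t != 0 -> peval F (curve_at orbit_curve t) = 0) -> peval F C = 0.
  move=> /multidegree_homogeneous hF Fq; apply/(vanishesP hF Cx).
  apply: (zariski_closure_min (zariski_closed_vanishes hF) _ Zx) => y [t t0 hy].
  by apply/(vanishesP hF hy)/Fq.
split=> [i k ic kc|k kabd|].
- rewrite -peval_var; apply: (vanish _ _ (@multidegree_var K _ n i k)) => t t0.
  by rewrite peval_var mxE /orbit_curve (negPf ic) (negPf kc) horner0.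
- rewrite -peval_var; apply: (vanish _ _ (@multidegree_var K _ n (Some c) k)) => t t0.
  by rewrite peval_var mxE /orbit_curve eqxx (negPf kabd) horner0.
pose X j : mpolyring K (option 'I_n.+1) n := 'X_(enum_rank (Some c, j)).
have pevalF C' : peval (X b ^+ (w d - w a) - X a ^+ (w d - w b) * X d ^+ (w b - w a)) C'
    = C' (Some c) 0 b ^+ (w d - w a)
      - C' (Some c) 0 a ^+ (w d - w b) * C' (Some c) 0 d ^+ (w b - w a).
  rewrite /peval mevalB mevalM !rmorphXn /=.
  by rewrite !mevalXU !enum_rankK.
apply/eqP; rewrite -subr_eq0 -pevalF; apply/eqP.
have dX j k : multidegree (X j ^+ k) (fun i => k * (Some c == i))%N.
  exact/multidegreeX/multidegree_var.
(* Both monomials have the same degree, as (w d - w b) + (w b - w a) = w d - w a. *)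
apply: vanish (multidegreeB _ (dX b _) (multidegreeM (dX a _) (dX d _))) _ => [i|t t0].
  by rewrite -mulnDl; congr (_ * _)%N; lia.
rewrite pevalF !mxE /orbit_curve !eqxx !orbT /= !hornerXn -!exprM -exprD.
apply/eqP; rewrite subr_eq0; apply/eqP; congr (_ ^+ _).
(* The exponents of t agree: w_b (w_d - w_a) = w_a (w_d - w_b) + w_d (w_b - w_a). *)
by rewrite -(subnK (ltnW wab)) -(subnK (ltnW wbd)); nia.
Qed.

Lemma orbit_closure_blowup : zariski_closure orbit `<=` blowup K n.
Proof.
move=> x Zx; have [C Cx] := ex_hcoords x.
have [C0 Cabd _] := orbit_closure_coords Zx Cx.
apply: (blowup_hcoords Cx) => i; have [->|ic] := eqVneq i c.
  split=> [|j k jc kc]; first by apply: Cabd; rewrite !neqs.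
  by rewrite (C0 None j) // (C0 None k) // !mul0r.
split=> [|j k ji ki]; first by rewrite C0.
have [->|kc] := eqVneq k c; last first.
  by rewrite (C0 None k) // (C0 (Some i) k) // mulr0 mul0r.
have [->//|jc] := eqVneq j c.
by rewrite (C0 None j) // (C0 (Some i) j) // mulr0 mul0r.
Qed.

Lemma orbit_closure_subvariety : subvariety (zariski_closure orbit).
Proof.
split; [exact: orbit_closure_blowup | exact: zariski_closed_closure |].
by apply: curve_closure_irreducible orbit_param _ => x.
Qed.

(** Distinct weights leave a fixed point only one nonzero coordinate in the factor [Some c], and the
    binomial relation rules out [b]. *)
Lemma orbit_closure_fixed x : Gm_fixed v (zariski_closure orbit) x ->
  exists2 l, l = a \/ l = d & hcoords (flag_coords c l) x.
Proof.
move=> [Zx fx]; have [C Cx] := ex_hcoords x.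
have [C0 Cabd Cb] := orbit_closure_coords Zx Cx.
have single j k : C (Some c) 0 j != 0 -> C (Some c) 0 k != 0 -> j = k.
  move=> j0 k0; apply/w_inj/(@exp_inj_nonzeros K) => t t0.
  have := vw (exist _ t t0) Cx; rewrite fx /= => Ct.
  have := hcoords_minor (Some c) j k Cx Ct; rewrite !mxE mulrCA [RHS]mulrCA.
  by rewrite [C _ _ k * _]mulrC => /(mulIf (mulf_neq0 j0 k0)).
(* If y_b were nonzero, the relation would make y_a nonzero too, because its exponent w d - w b is
   positive. *)
have yb : C (Some c) 0 b = 0.
  apply/eqP/negPn/negP => yb; have := expf_neq0 (w d - w a) yb.
  rewrite Cb mulf_eq0 negb_or !expf_eq0 subn_gt0 wbd => /andP[/(single _ _ yb) ba' _].
  by have := (neqw wab).2; rewrite ba' eqxx.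
have [l hl] := rV0Pn _ (hcoords_neq0 (Some c) Cx).
exists l.
  suff /orP[/eqP|/eqP] : (l == a) || (l == d) by [left | right].
  apply: contraNT hl => /norP[la ld].
  have [->|lb] := eqVneq l b; first by rewrite yb.
  by rewrite Cabd // (negPf la) (negPf lb).
have C_flag i k : k != flag c l i -> C i 0 k = 0.
  rewrite /flag; have [->|ic] := eqVneq i (Some c) => kl; last exact: C0.
  by apply/eqP; apply: contraNT kl => /single/(_ hl)->.
move=> i; have /rV0Pn[k Ck] := hcoords_neq0 i Cx.
have kE : k = flag c l i by apply/eqP; apply: contraNT Ck => /C_flag->.
rewrite Cx -(vline_scale (flag_coords c l i) Ck); congr (<[_]>%VS).
apply/rowP => j; rewrite !mxE /= -kE.
by have [->|jk] := eqVneq j k; rewrite ?mulr1 // mulr0 C_flag // -kE.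
Qed.

Lemma bb_closure_not_convex : ~ Gm_convex v (zariski_closure (bb_cell v p)).
Proof.
move=> /(_ _ orbit_closure_subvariety orbit_closure_stable)[_ sub].
(* The point at t = 1 has y_b = 1, so it cannot lie in the cell closure. *)
have [x ox hx] := orbit_param (oner_neq0 K).
have /sub/(_ x (subset_zariski_closure ox)) Yx :
    Gm_fixed v (zariski_closure orbit) `<=`
    Gm_fixed v (zariski_closure (bb_cell v p)).
  move=> y yfix; have [l lad hy] := orbit_closure_fixed yfix.
  by split; [exact: bb_closure_flag hy | case: yfix].
have := bb_closure_vanish Yx hx.
rewrite mxE /orbit_curve !eqxx orbT hornerXn expr1n => /eqP.
by rewrite oner_eq0.
Qed.
End Blowup.

(** * Choice of four weights, and the theorem *)

Lemma four_increasing (n : nat) (w : 'I_n.+1 -> nat) : (3 <= n)%N -> injective w ->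
  exists a b c d, [/\ (w a < w b)%N, (w b < w c)%N & (w c < w d)%N].
Proof.
move=> hn w_inj; pose s := sort leq (codom w).
have sz : size s = n.+1 by rewrite size_sort size_codom card_ord.
(* Distinct weights sort into a strictly increasing list, whose first four entries are used. *)
have s_lt : sorted ltn s.
  rewrite ltn_sorted_uniq_leq sort_uniq sort_sorted ?andbT; last exact: leq_total.
  exact/injectiveP.
have s_w i : (i < n.+1)%N -> exists j, w j = nth 0 s i.
  move=> si; have : nth 0 s i \in codom w by rewrite -(mem_sort leq) mem_nth ?sz.
  by case/codomP => j ->; exists j.
have step i : (i.+1 < n.+1)%N -> (nth 0 s i < nth 0 s i.+1)%N.
  by move=> si; apply: (sortedP 0 s_lt); rewrite sz.
have [lt1 lt2 lt3] : [/\ 1 < n.+1, 2 < n.+1 & 3 < n.+1]%N by split; lia.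
have [[a wa] [b wb]] := (s_w 0%N isT, s_w 1%N lt1).
have [[c wc] [d wd]] := (s_w 2%N lt2, s_w 3%N lt3).
by exists a, b, c, d; rewrite wa wb wc wd; split; apply: step.
Qed.

Theorem theoremI (K : closedFieldType) (n : nat) (hn : (3 <= n)%N)
    (v : Gm K -> torus K n) (hv : cocharacter v) (hadm : admissible v) :
  exists p : ambient K n,
    Gm_fixed v (blowup K n) p /\
    ~ Gm_convex v (zariski_closure (bb_cell v p)).
Proof.
have [w vw] := cocharacter_weights hv.
have w_inj := admissible_weights_inj vw hadm.
have [a [b [c [d [wab wbc wcd]]]]] := four_increasing hn w_inj.
have [p hp pB] : exists2 p, hcoords (flag_coords K a c) p & blowup K n p.
  by apply: flag_point; apply: contraTneq (ltn_trans wab wbc) => ->; rewrite ltnn.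
exists p; split; last exact: (bb_closure_not_convex vw w_inj wab wbc wcd hp).
by split=> // t; apply: flag_fixed vw _ _ _ _ hp.
Qed.
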